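(* Let $c>0$, $r>0$, $\underline{\tau}>0$, $\underline{\Delta}>0$, and set $$\tau'=\sqrt{\left(\tfrac r2\right)^2+\frac{r}{2\pi c^2}}-\frac r2,\qquad \tau''=\frac{1}{2\pi c^2}.$$ Suppose that $$z\,\Omega\!\left(\frac{z\,\underline{\Delta}\,\underline{\tau}}{2}\right)<c\qquad\text{for all } z \text{ with } (\tau'')^{-1/2}\le z\le(\tau')^{-1/2}.$$ Define the following subsets of $\{(\tau,\mu):\tau>0,\ \mu\in\mathbb R\}$: - **Continue**: $|\mu|\le \dfrac{\mho\left(c\sqrt{\tau(\tau+r)/r}\right)}{\sqrt{\tau(\tau+r)/r}}$ (empty for those $\tau$ where the right-hand side is negative); - **Stop1**: $\mu\ge\max\left(0,\ \mho(c\sqrt\tau)/\sqrt\tau\right)$; - **Stop0**: $\mu\le\min\left(0,\ -\mho(c\sqrt\tau)/\sqrt\tau\right)$; - **Indeterminate**: all $(\tau,\mu)$ in none of the three sets above. Then these decision regions completely specify the agent's behavior for $\underline{\tau}$ and $\underline{\Delta}$, in the following sense. For every $\tau\ge\underline{\tau}$: 1. if $(\tau,\mu)\in$ **Stop1**, then in state $(\mu,\tau)$ it is optimal to stop and choose $d_1$; if $(\tau,\mu)\in$ **Stop0**, it is optimal to stop and choose $d_0$; if $(\tau,\mu)\in$ **Continue**, it is optimal to take another observation; 2. for no $m\in\mathbb R$ is the band $\{\tau\}\times[m,\,m+\underline{\Delta}\,\underline{\tau}/\tau]$ contained entirely in **Indeterminate**.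
   Context: Special functions. $\phi$ and $\Phi$ are the standard Gaussian density and distribution function; $\Omega(s)=\phi(s)-(1-\Phi(s))\,s$ for $s\in\mathbb R$, which is a strictly decreasing bijection $\mathbb R\to(0,\infty)$; $\mho:(0,\infty)\to\mathbb R$ is its inverse function. Planning to observe problem. An unknown real $\theta$ can be observed through observations $X_1,X_2,\dots$ that, given $\theta$, are i.i.d. Gaussian with mean $\theta$ and known variance $1/r$. Each observation costs $c$. At any time the agent either takes a new observation or stops and makes a terminal decision $d_0$ (''$\theta$ smaller than zero'') or $d_1$ (''$\theta$ larger than zero''). The terminal losses are $L(\theta,d_0)=\max(\theta,0)$ and $L(\theta,d_1)=\max(-\theta,0)$. Bayesian states and optimality. If the current distribution of $\theta$ is Gaussian with mean $\mu$ and variance $1/\tau$ (state $(\mu,\tau)$), then after one observation $x$ it is Gaussian with mean $(\tau\mu+rx)/(\tau+r)$ and variance $1/(\tau+r)$. For a plan $\delta$ (a sequential stopping rule together with a terminal decision), the Bayes risk is $\rho(\mu,\tau,\delta)=E[L(\theta,\delta)+nc]$, where $n$ is the (random) number of observations taken. Let $\rho(\mu,\tau)=\inf_\delta\rho(\mu,\tau,\delta)$. The risk of stopping immediately with the better decision is $\rho_0(\mu,\tau)=\Omega(\sqrt\tau|\mu|)/\sqrt\tau$. ''It is optimal to stop and choose $d_i$'' means that $\rho(\mu,\tau)$ equals the expected loss $E[L(\theta,d_i)]$ under the Gaussian distribution with mean $\mu$ and variance $1/\tau$. ''It is optimal to take another observation'' means that $c+E\left[\rho\left(\frac{\tau\mu+rX}{\tau+r},\tau+r\right)\right]\le\rho_0(\mu,\tau)$,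 where $X$ is Gaussian with mean $\mu$ and variance $1/\tau+1/r$ (the predictive distribution). Quasi-Bayesian agent. The prior beliefs are the set of convex combinations of Gaussians with variance $1/\underline{\tau}$ and means ranging over an interval of width $\underline{\Delta}$. After $n$ observations, applying Bayes rule to each distribution gives convex combinations of Gaussians with inverse variance $\tau=\underline{\tau}+nr$ and means ranging over an interval of width $\underline{\Delta}\,\underline{\tau}/\tau$; this interval of means at $\tau$ is the ''band''. The agent's behavior is completely specified by decision regions when each determinate region gives an action that is optimal for the corresponding Gaussian, and the band never lies entirely inside the Indeterminate region (so that some Gaussian in the set always has a determined optimal action). *)

(* Defs.v *)
From HB Require Import structures.
From mathcomp Require Import all_boot all_order all_algebra.
From mathcomp Require Import all_classical all_reals all_analysis.

Set Implicit Arguments.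
Unset Strict Implicit.
Unset Printing Implicit Defensive.

Import Order.TTheory GRing.Theory Num.Theory.
Import numFieldNormedType.Exports.

Local Open Scope classical_set_scope.
Local Open Scope ring_scope.

(* The second argument of [normal_pdf] and [normal_prob] is a standard
   deviation, so the Gaussian law with mean m and variance v is
   [normal_prob m (Num.sqrt v)]. *)

Section special_functions.
Context {R : realType}.

Definition Phi (s : R) : R := fine (normal_prob (0 : R) 1 `]-oo, s]).

Definition Omega (s : R) : R := normal_pdf 0 1 s - (1 - Phi s) * s.

(* Omega is a bijection from R onto the positive reals; the default value 0
   is only taken outside of its range. *)
Definition mho (y : R) : R := xget 0 [set s : R | Omega s = y].

End special_functions.

Definition decision := bool.
Definition d0 : decision := false.
Definition d1 : decision := true.

Definition loss {R : realType} (theta : R) (d : decision) : R :=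
  if d then Num.max (- theta) 0 else Num.max theta 0.

(* [stop n x] tells whether to stop after having observed the n values x
   (n = 0: before any observation), [decide n x] is the decision then made.
   The rule is only consulted as long as it has not stopped earlier. *)
Record plan (R : realType) := Plan {
  stop : forall n, n.-tuple R -> bool ;
  decide : forall n, n.-tuple R -> decision ;
  measurable_stop : forall n, measurable_fun [set: n.-tuple R] (@stop n) ;
  measurable_decide : forall n, measurable_fun [set: n.-tuple R] (@decide n) }.

Definition observed {R : realType} (x : nat -> R) (n : nat) : n.-tuple R :=
  [tuple x i | i < n].

(* L(theta, delta) + n c for the observation sequence x 0, x 1, ..., where n is
   the first time at which the plan stops; a plan that never stops pays for
   infinitely many observations. *)
Definition total_loss {R : realType} (c : R) (delta : plan R)
    (theta : R) (x : nat -> R) : \bar R :=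
  if pselect (exists n, stop delta (observed x n)) is left stopping
  then let n := ex_minn stopping in
       (loss theta (decide delta (observed x n)) + n%:R * c)%:E
  else +oo%E.

(* Under P mu tau, theta is Gaussian with mean mu and variance 1/tau and,
   given theta, the X i are i.i.d. Gaussian with mean theta and variance 1/r. *)
Definition gaussian_model {R : realType} {d : measure_display}
    {T : measurableType d} (r : R) (P : R -> R -> probability T R)
    (theta : T -> R) (X : nat -> T -> R) : Prop :=
  [/\ measurable_fun [set: T] theta,
      forall i, measurable_fun [set: T] (X i) &
      forall mu tau, 0 < tau ->
      forall (B : set R) (n : nat) (A : nat -> set R),
        measurable B -> (forall i, measurable (A i)) ->
        P mu tau (theta @^-1` B `&` \bigcap_(i in `I_n) (X i @^-1` A i)) =
        (\int[normal_prob mu (Num.sqrt (1 / tau))]_(t in B)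
           \prod_(i < n) normal_prob t (Num.sqrt (1 / r)) (A i))%E].

Section risks.
Context {R : realType} {d : measure_display} {T : measurableType d}.
Variables (c r : R) (P : R -> R -> probability T R).
Variables (theta : T -> R) (X : nat -> T -> R).

Definition risk_of (mu tau : R) (delta : plan R) : \bar R :=
  (\int[P mu tau]_w total_loss c delta (theta w) (X ^~ w))%E.

Definition risk (mu tau : R) : \bar R :=
  ereal_inf [set risk_of mu tau delta | delta in [set: plan R]].

Definition risk0 (mu tau : R) : R :=
  Omega (Num.sqrt tau * `|mu|) / Num.sqrt tau.

Definition expected_loss (mu tau : R) (di : decision) : \bar R :=
  (\int[normal_prob mu (Num.sqrt (1 / tau))]_t (loss t di)%:E)%E.

Definition optimal_stop (mu tau : R) (di : decision) : Prop :=
  risk mu tau = expected_loss mu tau di.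

Definition optimal_continue (mu tau : R) : Prop :=
  (c%:E + \int[normal_prob mu (Num.sqrt (1 / tau + 1 / r))]_x
            risk ((tau * mu + r * x) / (tau + r)) (tau + r)
     <= (risk0 mu tau)%:E)%E.

End risks.

Section regions.
Context {R : realType}.
Variables (c r : R).

Definition tau' : R :=
  Num.sqrt ((r / 2) ^+ 2 + r / (2 * pi * c ^+ 2)) - r / 2.

Definition tau'' : R := 1 / (2 * pi * c ^+ 2).

(* Regions are sets of pairs (tau, mu). *)

Definition Continue : set (R * R) :=
  [set p | 0 < p.1 /\
     `|p.2| <= mho (c * Num.sqrt (p.1 * (p.1 + r) / r))
               / Num.sqrt (p.1 * (p.1 + r) / r)].

Definition Stop1 : set (R * R) :=
  [set p | 0 < p.1 /\
     p.2 >= Num.max 0 (mho (c * Num.sqrt p.1) / Num.sqrt p.1)].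

Definition Stop0 : set (R * R) :=
  [set p | 0 < p.1 /\
     p.2 <= Num.min 0 (- mho (c * Num.sqrt p.1) / Num.sqrt p.1)].

Definition Indeterminate : set (R * R) :=
  [set p | 0 < p.1] `\` (Continue `|` Stop1 `|` Stop0).

(* [Delta] is the width of the interval of means in the prior set, whose
   elements have precision [tau0]. *)
Definition band (tau0 Delta tau m : R) : set (R * R) :=
  [set tau] `*` `[m, m + Delta * tau0 / tau].

End regions.

(* Main.v *)
Require Import Defs.
From HB Require Import structures.
From mathcomp Require Import all_boot all_order all_algebra.
From mathcomp Require Import all_classical all_reals all_analysis.
From mathcomp Require Import measurable_realfun.
From mathcomp Require Import ring lra.

(* In Stop1 and Stop0 the expected loss of stopping with the better decision is at
   most c, the price of a single observation, so no plan can do better. In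
   Continue, stopping right after the next observation already compensates for its
   cost: its expected risk is risk0 - Omega(s |mu|) / s with
   s = sqrt(tau (tau + r) / r), as Omega x is the expectation of max(Z - x, 0) for Z
   standard Gaussian.

   For the band, write Omega u = c sqrt(tau), Omega v = c s, k = sqrt(tau) / s. For
   tau >= tau', Continue plays no role and the hypothesis at z = tau^(-1/2) says that
   the band is wider than the gap between Stop0 and Stop1. For tau < tau', each of
   the two components of Indeterminate has width w with
   c tau w = Omega u (u - k v), while at tau' the hypothesis gives
   2 u1 Omega u1 < c Delta tau0 with Omega u1 = c sqrt(tau'). It remains to show
   Omega u (u - k v) <= 2 u1 Omega u1, which follows from the convexity of Omega and
   from Omega <= 2 Omega(0) (1 - Phi) on the nonnegative reals, itself a consequence
   of the log-concavity of Omega. *)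

Set Implicit Arguments.
Unset Strict Implicit.
Unset Printing Implicit Defensive.

Import Order.TTheory GRing.Theory Num.Theory.
Import numFieldNormedType.Exports.

Local Open Scope classical_set_scope.
Local Open Scope ring_scope.

(** * The standard Gaussian distribution *)

Section gaussian.
Context {R : realType}.
Implicit Types x y u v m s : R.

Local Notation phi := (normal_pdf (0 : R) 1).
Local Notation G x := (1 - Phi x).

(** The mean value theorem, with the derivative as an explicit function; it carries the monotonicity
    arguments below. *)
Lemma derive_nonpos_antitone (f df : R -> R) x y :
  (forall z, x <= z <= y -> is_derive z 1 f (df z)) ->
  (forall z, x <= z <= y -> df z <= 0) -> x <= y -> f y <= f x.
Proof.
move=> fdf df0; rewrite le_eqVlt => /predU1P[->//|xy].
have [||c + fyx] := @MVT _ f df x y xy.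
- by move=> z; rewrite in_itv/= => /andP[xz zy]; apply: fdf; rewrite !ltW.
- apply: continuous_in_subspaceT => z; rewrite inE/= in_itv/= => xz.
  by apply/differentiable_continuous/derivable1_diffP; have [] := fdf z xz.
- rewrite in_itv/= => /andP[xc cy].
  by rewrite -subr_le0 fyx mulr_le0_ge0 ?subr_ge0 ?(ltW xy)// df0// !ltW.
Qed.

Lemma std_normal_pdfE x : phi x = phi 0 * expR (- (x ^+ 2 / 2)).
Proof.
rewrite normal_pdfE ?oner_neq0// /normal_fun !subr0 expr1n expr0n/= oppr0 mul0r.
by rewrite expR0 mulr1 mulNr.
Qed.

Lemma std_normal_pdf_gt0 x : 0 < phi x.
Proof.
by rewrite normal_pdfE ?oner_neq0// mulr_gt0 ?expR_gt0 ?normal_peak_gt0 ?oner_neq0.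
Qed.

Lemma std_normal_pdf0_sq : phi 0 ^+ 2 = (2 * pi)^-1.
Proof.
rewrite normal_pdfE ?oner_neq0// /normal_fun subr0 expr0n/= oppr0 mul0r expR0.
rewrite mulr1 /normal_peak exprVn sqr_sqrtr ?expr1n ?mul1r ?mulr_natl//.
by rewrite mulrn_wge0 ?pi_ge0.
Qed.

Lemma std_normal_pdf_even x : phi (- x) = phi x.
Proof. by rewrite std_normal_pdfE sqrrN -std_normal_pdfE. Qed.

Lemma continuous_std_normal_pdf : continuous phi.
Proof. by apply: continuous_normal_pdf; rewrite oner_neq0. Qed.

Lemma is_derive_std_normal_pdf x : is_derive x 1 phi (- x * phi x).
Proof.
have -> : phi = (fun z => phi 0 * expR (- (z ^+ 2 / 2))).
  by apply/funext => z; exact: std_normal_pdfE.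
have h : is_derive x 1 (fun z => - (z ^+ 2 / 2)) (- x).
  have -> : (fun z : R => - (z ^+ 2 / 2)) = (- 2^-1) *: ((@id R) ^+ 2).
    by apply/funext => z; rewrite !fctE/= /GRing.scale/=; ring.
  by apply: is_derive_eq; rewrite /GRing.scale/=; field.
have -> : (fun z => phi 0 * expR (- (z ^+ 2 / 2))) =
          (phi 0 *: (expR \o (fun z : R => - (z ^+ 2 / 2)))) by [].
have he := is_derive1_comp (is_derive_expR _) h.
by apply: is_derive_eq; rewrite /GRing.scale/=; ring.
Qed.

Lemma is_derive_Phi x : is_derive x 1 Phi (phi x).
Proof.
have fi u : lebesgue_measure.-integrable `]-oo, u] (EFin \o phi).
  by apply: (integrableS _ _ (@subsetT _ _)) => //; exact: integrable_normal_pdf.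
have [] := @continuous_FTC1 R phi -oo%O x (x + 1) _ (fi _) _ _.
- by rewrite ltrDl.
- by rewrite ltNyr.
- exact: continuous_std_normal_pdf.
by move=> dP PE; split; [exact: dP|rewrite -derive1E PE].
Qed.

Lemma Phi_le1 x : Phi x <= 1.
Proof.
by rewrite -lee_fin /Phi fineK ?fin_num_measure// probability_le1.
Qed.

(** The identity as a random variable: its distribution function under [normal_prob 0 1] is [Phi],
    which yields the limit of [Phi] at infinity. *)
Let idTR : measurableTypeR R -> R := idfun.

#[local] HB.instance Definition _ :=
  @isMeasurableFun.Build _ _ _ _ idTR (@measurable_id _ _ setT).

Lemma cvg_upper_tail : G x @[x --> +oo] --> (0 : R).
Proof.
rewrite [X in _ --> X](_ : 0 = 1 - 1); last by rewrite subrr.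
apply: cvgB; first exact: cvg_cst.
exact: (fine_cvg (@cvg_cdfy1 _ _ _ (normal_prob (0 : R) 1) idTR)).
Qed.

(** As [phi] is even with integral 1, reflection shows that each half-line carries mass 1/2. *)
Lemma Phi0 : Phi (0 : R) = 2^-1.
Proof.
have phi_ge0 x : 0 <= phi x by exact: normal_pdf_ge0.
have evenphi : phi =1 phi \o -%R by move=> x /=; rewrite std_normal_pdf_even.
have := ge0_symfun_integralT phi_ge0 continuous_std_normal_pdf evenphi.
rewrite integral_normal_pdf -set_itvcy.
have <- : (\int[lebesgue_measure]_(x in `]-oo, 0%R]) (phi x)%:E =
    \int[lebesgue_measure]_(x in `[0%R, +oo[) (phi x)%:E)%E.
  have := @ge0_integration_by_substitutionNy R phi 0; rewrite oppr0 => ->.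
  - by apply: eq_integral => x _; rewrite [in RHS]evenphi.
  - by apply: continuous_subspaceT; exact: continuous_std_normal_pdf.
  - by move=> x _; exact: phi_ge0.
rewrite -[X in (_ * X)%E](@fineK _ (normal_prob 0 1 `]-oo, 0%R])) ?fin_num_measure//.
rewrite -EFinM => -[] /esym h; apply: (@mulfI _ 2); first by rewrite pnatr_eq0.
by rewrite mulfV ?pnatr_eq0.
Qed.

Lemma is_derive_upper_tail x : is_derive x 1 (fun z => G z) (- phi x).
Proof.
have -> : (fun z => G z) = cst 1 - (Phi : R -> R) by [].
have ? := is_derive_Phi x.
by apply: is_derive_eq; rewrite sub0r.
Qed.

Lemma is_derive_Omega x : is_derive x 1 Omega (- G x).
Proof.
have -> : (Omega : R -> R) = phi - (fun z => G z) * (@id R) by [].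
have ? := is_derive_std_normal_pdf x.
have ? := is_derive_upper_tail x.
by apply: is_derive_eq; rewrite /GRing.scale/=; ring.
Qed.

(** * Bounds on the Gaussian upper tail *)

Lemma upper_tail_ge0 x : 0 <= G x.
Proof. by rewrite subr_ge0 Phi_le1. Qed.

Lemma upper_tail_antitone x y : x <= y -> G y <= G x.
Proof.
apply: (@derive_nonpos_antitone (fun z => G z) (fun z => - phi z)).
- by move=> z _; exact: is_derive_upper_tail.
- by move=> z _; rewrite oppr_le0 normal_pdf_ge0.
Qed.

(* f is bounded below by its limit at infinity, which is nonnegative as phi
   tends to 0. *)
Lemma antitone_ge_tail_ge0 (f : R -> R) x : 0 <= x ->
  (forall u v, 0 <= u -> u <= v -> f v <= f u) ->
  (forall u, 0 <= u -> - phi u <= f u) -> 0 <= f x.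
Proof.
move=> x0 fanti fphi; rewrite leNgt; apply/negP => fx0.
(* A point beyond [x] where [phi] is below [- f x]: as [y < 1 + y^2 / 2 <= expR (y^2 / 2)], it
   suffices that [- f x * y >= 2 * phi 0]. *)
pose y := Num.max x (2 * phi 0 / - f x).
have y0 : 0 <= y by rewrite le_max x0.
have := le_trans (fphi y y0) (fanti x y x0 _).
rewrite le_max lexx => /(_ isT); apply/negP; rewrite -ltNge ltrNr.
have yf : 2 * phi 0 / - f x <= y by rewrite le_max lexx orbT.
have y_gt0 : 0 < y.
  by rewrite (lt_le_trans _ yf)// divr_gt0 ?oppr_gt0// mulr_gt0 ?std_normal_pdf_gt0.
rewrite ler_pdivrMr ?oppr_gt0// in yf.
have e : 1 + y ^+ 2 / 2 <= expR (y ^+ 2 / 2) by exact: expR_ge1Dx.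
have y2 : y < 1 + y ^+ 2 / 2 by nra.
rewrite std_normal_pdfE expRN ltr_pdivrMr ?expR_gt0//.
have p0 := std_normal_pdf_gt0 0.
have : - f x * (1 + y ^+ 2 / 2) <= - f x * expR (y ^+ 2 / 2).
  by rewrite ler_pM2l ?oppr_gt0.
nra.
Qed.

Let is_derive_add1_sqr x : is_derive x 1 (fun z : R => 1 + z ^+ 2) (2 * x).
Proof.
have -> : (fun z => 1 + z ^+ 2 : R) = cst 1 + (@id R) ^+ 2 by [].
have hX := is_deriveX 2 (is_derive_id x (1 : R)).
have hD := is_deriveD (is_derive_cst (1 : R) x (1 : R)) hX.
apply: (is_derive_eq hD).
by rewrite /GRing.scale/=; ring.
Qed.

(** The classical lower bound on the Mills ratio: the difference [G z - z * phi z / (1 + z^2)] has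
    derivative [- 2 * phi z / (1 + z^2)^2], so it decreases to a nonnegative limit. *)
Lemma mills_lower u : 0 <= u -> u * phi u <= (1 + u ^+ 2) * G u.
Proof.
move=> u0; have d0 z : 0 < 1 + z ^+ 2 :> R by rewrite ltr_pwDl// sqr_ge0.
rewrite [leRHS]mulrC -ler_pdivrMr// -subr_ge0.
pose f z := G z - z * phi z / (1 + z ^+ 2).
apply: (@antitone_ge_tail_ge0 f) => // [x y _ xy|x x0]; rewrite /f.
  apply: (@derive_nonpos_antitone f (fun z => - (2 * phi z / (1 + z ^+ 2) ^+ 2))).
  - move=> z _; have dz := lt0r_neq0 (d0 z).
    have hG := is_derive_upper_tail z; have hp := is_derive_std_normal_pdf z.
    have h := is_derive_add1_sqr z.
    have hV := @is_deriveV _ (fun z => 1 + z ^+ 2) _ _ _ dz h.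
    have -> : f = (fun z => G z) - (@id R) * phi * (fun z => (1 + z ^+ 2)^-1).
      by [].
    by apply: is_derive_eq; rewrite ?fctE /GRing.scale/=; field.
  - move=> z _.
    by rewrite oppr_le0 divr_ge0 ?mulr_ge0 ?normal_pdf_ge0 ?exprn_ge0 ?ltW.
  - exact: xy.
have : x * phi x / (1 + x ^+ 2) <= phi x.
  rewrite ler_pdivrMr// mulrC ler_wpM2l ?normal_pdf_ge0//; nra.
have := upper_tail_ge0 x; lra.
Qed.

(** Moving right to a point at least 1 only decreases the tail, and there the Mills bound is
    positive. *)
Lemma upper_tail_gt0 x : 0 < G x.
Proof.
have x1 : x <= Num.max x 1 by rewrite le_max lexx.
apply: lt_le_trans (upper_tail_antitone x1).
set y := Num.max _ _; have y1 : 1 <= y by rewrite le_max lexx orbT.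
have := @mills_lower y (le_trans ler01 y1).
have := std_normal_pdf_gt0 y; nra.
Qed.

(** Log-concavity of [Omega], since [Omega' = - G] and [Omega'' = phi]. The derivative of the
    difference is nonpositive exactly by [mills_lower]. *)
Lemma Omega_le_sq_tail u : 0 <= u -> phi u * Omega u <= G u ^+ 2.
Proof.
move=> u0; rewrite -subr_ge0.
(* Dividing by [phi 0] gives the lower bound [- phi], because [Omega x <= phi x <= phi 0] for
   nonnegative [x]. *)
pose f z := (G z ^+ 2 - phi z * Omega z) / phi 0.
suff : 0 <= f u by rewrite pmulr_lge0// invr_gt0 std_normal_pdf_gt0.
have p0 := std_normal_pdf_gt0 0.
apply: antitone_ge_tail_ge0 => // [x y x0 xy|x x0]; rewrite /f.
  apply: (@derive_nonpos_antitone f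
    (fun z => - (phi z * ((1 + z ^+ 2) * G z - z * phi z) / phi 0))).
  - move=> z _.
    have hG := is_derive_upper_tail z; have hp := is_derive_std_normal_pdf z.
    have hO := is_derive_Omega z.
    have -> : f = (phi 0)^-1 *: ((fun z => G z) ^+ 2 - phi * Omega).
      by apply/funext => w; rewrite /f /GRing.scale/= mulrC.
    apply: is_derive_eq; rewrite ?fctE /GRing.scale/= /Omega; field.
    exact: lt0r_neq0.
  - move=> z /andP[xz _]; rewrite oppr_le0 divr_ge0 ?(ltW p0)//.
    rewrite mulr_ge0 ?normal_pdf_ge0//.
    by rewrite subr_ge0 mills_lower// (le_trans x0).
  - exact: xy.
rewrite ler_pdivlMr//.
have px : phi x <= phi 0.
  rewrite std_normal_pdfE ler_piMr ?(ltW p0)// -[leRHS]expR0 ler_expR.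
  by rewrite oppr_le0 divr_ge0 ?sqr_ge0.
have : Omega x <= phi x by rewrite gerBl mulr_ge0// upper_tail_ge0.
have := std_normal_pdf_gt0 x; have := sqr_ge0 (G x); nra.
Qed.

(** * Monotonicity, convexity and inverse of [Omega] *)

Lemma Omega0 : Omega (0 : R) = phi 0.
Proof. by rewrite /Omega mulr0 subr0. Qed.

Lemma Omega_antitone x y : x <= y -> Omega y <= Omega x.
Proof.
apply: (@derive_nonpos_antitone Omega (fun z => - G z)).
- by move=> z _; exact: is_derive_Omega.
- by move=> z _; rewrite oppr_le0 upper_tail_ge0.
Qed.

Lemma continuous_Omega : continuous (Omega : R -> R).
Proof.
move=> x; apply/differentiable_continuous/derivable1_diffP.
by have [] := is_derive_Omega x.
Qed.

(** Convexity: [Omega] lies above its tangent at [x], as its slope [- G] is monotone and so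
    [Omega + G x *: id] is minimal at [x]. *)
Lemma Omega_tangent x y : Omega x - G x * (y - x) <= Omega y.
Proof.
pose f : R -> R := Omega + (G x *: @id R).
have df (z : R) : is_derive z 1 f (G x - G z).
  have hZ := is_deriveZ (G x) (is_derive_id z (1 : R)).
  apply: is_derive_eq (is_deriveD (is_derive_Omega z) hZ) _.
  by rewrite /GRing.scale/=; ring.
suff : f x <= f y by rewrite /f !fctE /GRing.scale/=; lra.
have [yx|xy] := leP y x.
  apply: (@derive_nonpos_antitone f (fun z => G x - G z)).
  - by move=> z /andP[_ zx]; rewrite subr_le0 upper_tail_antitone.
  - exact: yx.
rewrite -lerN2.
apply: (@derive_nonpos_antitone (- f) (fun z => G z - G x)).
- by move=> z _; have h := df z; apply: is_derive_eq; rewrite opprB.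
- by move=> z /andP[xz _]; rewrite subr_le0 upper_tail_antitone.
- exact: ltW.
Qed.

Lemma cvg_std_normal_pdf : phi x @[x --> +oo] --> (0 : R).
Proof.
have h : phi 0 * expR (- x) @[x --> +oo] --> (0 : R).
  rewrite -[X in _ --> X](mulr0 (phi 0)); apply: cvgM; first exact: cvg_cst.
  exact: cvgr_expR.
apply: (squeeze_cvgr _ (cvg_cst 0) h); near=> x.
rewrite normal_pdf_ge0 std_normal_pdfE ler_wpM2l ?normal_pdf_ge0// ler_expR lerN2.
have x2 : 2 <= x by near: x; apply: nbhs_pinfty_ge; rewrite num_real.
by nra.
Unshelve. all: by end_near. Qed.

(* By the fundamental theorem of calculus, as Omega s is minus the value at s
   of the antiderivative z |-> s (1 - Phi z) - phi z of (z - s) phi z. *)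
Lemma integral_itvcy_Omega s :
  (\int[lebesgue_measure]_(z in `[s, +oo[) ((z - s) * phi z)%:E = (Omega s)%:E)%E.
Proof.
pose F : R -> R := s *: (fun z => G z) - phi.
have dF (z : R) : is_derive z 1 F ((z - s) * phi z).
  have hG := is_derive_upper_tail z; have hp := is_derive_std_normal_pdf z.
  by apply: is_derive_eq; rewrite ?fctE /GRing.scale/=; ring.
have cF : continuous F.
  move=> z; apply/differentiable_continuous/derivable1_diffP.
  by have [] := dF z.
rewrite (@ge0_continuous_FTC2y R (fun z => (z - s) * phi z) F s 0).
- by rewrite sub0e -EFinN /F /Omega !fctE/= /GRing.scale/=; congr EFin; ring.
- by move=> z sz; rewrite mulr_ge0 ?subr_ge0 ?normal_pdf_ge0.
- apply: continuous_subspaceT => z; apply: cvgM; last exact: continuous_std_normal_pdf.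
  by apply: cvgB; [exact: cvg_id|exact: cvg_cst].
- rewrite -[X in _ --> X](subrr 0); apply: cvgB; last exact: cvg_std_normal_pdf.
  rewrite -[X in _ --> X](mulr0 s); apply: cvgM; first exact: cvg_cst.
  exact: cvg_upper_tail.
- by move=> z _; have [] := dF z.
- by apply: cvg_at_right_filter; exact: cF.
- by move=> z _; rewrite derive1E; have [] := dF z.
Qed.

(** The integral formula gives only nonnegativity; the tangent at [x + 1] adds the positive amount
    [G (x + 1)]. *)
Lemma Omega_gt0 x : 0 < Omega x.
Proof.
have O0 y : 0 <= Omega y.
  rewrite -lee_fin -integral_itvcy_Omega; apply: integral_ge0 => z /=.
  rewrite in_itv/= andbT => yz.
  by rewrite lee_fin mulr_ge0 ?subr_ge0 ?normal_pdf_ge0.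
have := Omega_tangent (x + 1) x; have := O0 (x + 1).
have := upper_tail_gt0 (x + 1); nra.
Qed.

Lemma Omega_strict_antitone x y : x < y -> Omega y < Omega x.
Proof. by have := Omega_tangent y x; have := upper_tail_gt0 y; nra. Qed.

Lemma le_Omega : {mono (Omega : R -> R) : x y /~ x <= y}.
Proof. by apply: le_nmono => x y; exact: Omega_strict_antitone. Qed.

(** By the intermediate value theorem [Omega] attains every positive value, so [xget] does not
    return its default here. *)
Lemma mhoK y : 0 < y -> Omega (mho y) = y.
Proof.
move=> y0; suff [s Os] : exists s, Omega s = y.
  by rewrite /mho; case: xgetP => [t -> //|/(_ s)].
have : \forall x \near +oo, phi x < y.
  by apply: (cvgr_lt 0) => //; exact: cvg_std_normal_pdf.
case=> M [_ hM]; set t := Num.max 0 (M + 1).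
have t0 : 0 <= t by rewrite le_max lexx.
have Ot : Omega t < y.
  apply: (@le_lt_trans _ _ (phi t)); first by rewrite gerBl mulr_ge0 ?upper_tail_ge0.
  by apply: hM; rewrite lt_max ltrDl ltr01 orbT.
(* The tangent at 0 has slope -1/2, so at [- (2 * y)] it is already [y] above [Omega 0]. *)
have Oy : y <= Omega (- (2 * y)).
  have := Omega_tangent 0 (- (2 * y)); rewrite Phi0.
  have := Omega_gt0 0; lra.
have [|||s _ <-] := @IVT R Omega (- (2 * y)) t y; last by exists s.
- by rewrite (le_trans _ t0)// oppr_le0 mulr_ge0// ltW.
- by apply: continuous_subspaceT; exact: continuous_Omega.
- by rewrite ge_min (ltW Ot) orbT le_max Oy.
Qed.

Lemma mho_le x y : 0 < y -> (mho y <= x) = (Omega x <= y).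
Proof. by move=> y0; rewrite -[in RHS](mhoK y0) le_Omega. Qed.

Lemma mho_ge x y : 0 < y -> (x <= mho y) = (y <= Omega x).
Proof. by move=> y0; rewrite -[in RHS](mhoK y0) le_Omega. Qed.

Lemma PhiN x : Phi (- x) = G x.
Proof.
apply: EFin_inj; rewrite EFinB /Phi !fineK ?fin_num_measure//.
rewrite -(probability_setC (normal_prob (0 : R) 1))// setCitvl.
rewrite [LHS]ge0_integration_by_substitutionNy.
- have -> : phi \o -%R = phi by apply/funext => z; exact: std_normal_pdf_even.
  rewrite -integral_itv_obnd_cbnd//.
  by apply/measurable_EFinP; apply: measurable_funTS; exact: measurable_normal_pdf.
- by apply: continuous_subspaceT; exact: continuous_std_normal_pdf.
- by move=> z _; exact: normal_pdf_ge0.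
Qed.

Lemma OmegaN x : Omega (- x) = Omega x + x.
Proof. by rewrite /Omega PhiN std_normal_pdf_even; ring. Qed.

(* The ratio Omega / (1 - Phi) is antitone, with value 2 Omega 0 at 0. *)
Lemma Omega_le_tail u : 0 <= u -> Omega u <= 2 * Omega 0 * G u.
Proof.
move=> u0; rewrite -ler_pdivrMr ?upper_tail_gt0//.
pose f (z : R) := Omega z / G z.
have -> : 2 * Omega 0 = f 0 by rewrite /f Phi0; field.
apply: (@derive_nonpos_antitone f (fun z => - ((G z ^+ 2 - phi z * Omega z) / G z ^+ 2))).
- move=> z _; have Gz := lt0r_neq0 (upper_tail_gt0 z).
  have hO := is_derive_Omega z.
  have hV := @is_deriveV _ (fun z => G z) _ _ _ Gz (is_derive_upper_tail z).
  have -> : f = Omega * (fun z => (G z)^-1) by [].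
  by apply: is_derive_eq; rewrite ?fctE /GRing.scale/=; field.
- move=> z /andP[z0 _]; rewrite oppr_le0 divr_ge0 ?sqr_ge0// subr_ge0.
  exact: Omega_le_sq_tail.
- exact: u0.
Qed.

End gaussian.
(** * The band is wider than each gap of the Indeterminate region *)

Section special_function_inequality.
Context {R : realType}.
Implicit Types u v k : R.

Local Notation G x := (1 - Phi x).

(** Integrated form of [Omega' <= - Omega / (2 * Omega 0)]: the tangent at [v], with its slope
    bounded by [Omega_le_tail]. *)
Lemma Omega_exp_decay u v : 0 <= u -> u <= v ->
  Omega v * (2 * Omega 0 + (v - u)) <= 2 * Omega 0 * Omega u.
Proof.
move=> u0 uv; have := Omega_tangent v u.
have := Omega_le_tail (le_trans u0 uv); have := @Omega_gt0 R 0; nra.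
Qed.

(* If u1 is at least Omega 0, the exponential decay of Omega suffices;
   otherwise Omega u1 is at least Omega 0 / 2, and both Omega u * (u - v) and
   Omega u * ((1 - k) * v) are controlled by 1 - k, that is, by u1. *)
Lemma Omega_gap_bound u v k u1 k1 :
  0 <= v -> v <= u -> 0 <= u1 -> u1 <= u ->
  Omega u = k * Omega v -> Omega u1 = k1 * Omega 0 -> k1 <= k <= 1 ->
  Omega u * (u - k * v) <= 2 * u1 * Omega u1.
Proof.
move=> v0 vu u10 u1u Ouk Ou1k1 /andP[k1k k1_].
have a0 := @Omega_gt0 R 0.
have k0 : 0 < k by rewrite -(pmulr_lgt0 _ (Omega_gt0 v)) -Ouk Omega_gt0.
have [au1|u1a] := leP (Omega 0) u1.
  have h := Omega_exp_decay u10 u1u.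
  apply: (@le_trans _ _ (Omega u * u)).
    by rewrite ler_pM2l ?Omega_gt0// gerBl mulr_ge0// ltW.
  rewrite -(ler_pM2l a0).
  have : u1 * (Omega u * (2 * Omega 0 + (u - u1))) <= u1 * (2 * Omega 0 * Omega u1).
    by rewrite ler_wpM2l.
  (* Without the factor [Omega u], the two sides differ by
     [Omega 0 * u1 + (u1 - Omega 0) * (u - u1)], which is nonnegative in this case. *)
  suff : Omega 0 * (Omega u * u) <= u1 * (Omega u * (2 * Omega 0 + (u - u1))) by lra.
  rewrite !(mulrCA _ (Omega u)) ler_pM2l ?Omega_gt0//; nra.
have t1 : Omega 0 - u1 / 2 <= Omega u1.
  by have := Omega_tangent 0 u1; rewrite Phi0; lra.
(* By [t1], [Omega 0 * (1 - k1) <= u1 / 2], and [k1 <= k]. *)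
have k1u1 : 2 * Omega 0 * (1 - k) <= u1 by nra.
have ev := Omega_exp_decay (lexx 0) v0; rewrite subr0 in ev.
have tuv : G u * (u - v) <= (1 - k) * Omega v.
  by have := Omega_tangent u v; rewrite Ouk; lra.
have uv : Omega u * (u - v) <= 2 * Omega 0 * ((1 - k) * Omega v).
  apply: (@le_trans _ _ (2 * Omega 0 * G u * (u - v))).
    by rewrite ler_wpM2r ?subr_ge0// Omega_le_tail// (le_trans v0).
  by rewrite -mulrA ler_wpM2l// mulr_ge0// ltW.
have kv : Omega u * ((1 - k) * v) <= (1 - k) * (Omega v * v).
  have : 0 <= (1 - k) * v by rewrite mulr_ge0// subr_ge0.
  have := Omega_antitone vu; nra.
(* Split [u - k * v] as [(u - v) + (1 - k) * v]; the two bounds add up to the left side of the decay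
   estimate [ev] from 0 to [v], times [1 - k]. *)
have bd : Omega u * (u - k * v) <= (1 - k) * (2 * Omega 0 * Omega 0).
  have : (1 - k) * (Omega v * (2 * Omega 0 + v)) <= (1 - k) * (2 * Omega 0 * Omega 0).
    by rewrite ler_wpM2l// subr_ge0.
  lra.
apply: le_trans bd _.
have : u1 * Omega 0 <= u1 * (2 * Omega u1) by rewrite ler_wpM2l//; lra.
have : 2 * Omega 0 * (1 - k) * Omega 0 <= u1 * Omega 0 by rewrite ler_wpM2r// ltW.
lra.
Qed.

End special_function_inequality.

(** * The thresholds [tau'] and [tau''], and the gaps between the regions *)

Section regions_gap.
Context {R : realType}.
Variables (c r tau0 Delta : R).
Hypotheses (c_gt0 : 0 < c) (r_gt0 : 0 < r).
Hypotheses (tau0_gt0 : 0 < tau0) (Delta_gt0 : 0 < Delta).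

(* The standard deviation of the mean after one observation is 1 / scale tau. *)
Let scale (tau : R) := Num.sqrt (tau * (tau + r) / r).

Let c2pi_gt0 : 0 < 2 * pi * c ^+ 2 :> R.
Proof. by rewrite !mulr_gt0 ?pi_gt0 ?exprn_gt0. Qed.

Lemma tau''_gt0 : 0 < tau'' c.
Proof. by rewrite divr_gt0. Qed.

Lemma tau'_gt0 : 0 < tau' c r.
Proof.
have r2 : 0 <= r / 2 by rewrite divr_ge0 ?ltW.
rewrite subr_gt0 -[ltLHS](ger0_norm r2) -sqrtr_sqr.
by rewrite ltr_sqrt ?ltrDl ?divr_gt0// addr_gt0 ?exprn_gt0 ?divr_gt0.
Qed.

(** Completing the square: [tau'] is the positive root of this quadratic equation. *)
Lemma tau'_eq : tau' c r * (tau' c r + r) = r * tau'' c.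
Proof.
have e : (tau' c r + r / 2) ^+ 2 = (r / 2) ^+ 2 + r * tau'' c.
  rewrite /tau' subrK sqr_sqrtr; first by rewrite /tau'' mul1r.
  by rewrite addr_ge0 ?sqr_ge0// divr_ge0 ?ltW.
by lra.
Qed.

(** So [mho (c * Num.sqrt tau)] vanishes at [tau'']: from there on [Stop0] and [Stop1] cover all
    means. *)
Lemma Omega0_tau'' : c * Num.sqrt (tau'' c) = Omega 0.
Proof.
rewrite Omega0; apply: (@pexpIrn _ 2); rewrite ?nnegrE ?normal_pdf_ge0//.
  by rewrite mulr_ge0 ?sqrtr_ge0// ltW.
rewrite exprMn sqr_sqrtr ?(ltW tau''_gt0)// std_normal_pdf0_sq /tau''.
by move: (pi_gt0 R); move: pi => p p0; field; rewrite !lt0r_neq0.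
Qed.

(** Hence [mho (c * scale tau)] vanishes at [tau'], where [Continue] shrinks to the mean 0. *)
Lemma scale_tau' : scale (tau' c r) = Num.sqrt (tau'' c).
Proof. by rewrite /scale tau'_eq mulrAC mulfV ?mul1r// lt0r_neq0. Qed.

Lemma scale_le (x y : R) : 0 < x <= y -> scale x <= scale y.
Proof.
move=> /andP[x0 xy]; rewrite ler_wsqrtr// ler_wpM2r ?invr_ge0 ?(ltW r_gt0)//.
by rewrite ler_pM ?lerD2r ?addr_ge0 ?(ltW x0) ?(ltW r_gt0).
Qed.

Hypothesis small_gap : forall z : R,
  (Num.sqrt (tau'' c))^-1 <= z <= (Num.sqrt (tau' c r))^-1 ->
  z * Omega (z * Delta * tau0 / 2) < c.

(** The hypothesis at [z = (Num.sqrt tau)^-1], read through [mho]; the left side is the distance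
    between [Stop0] and [Stop1]. *)
Lemma mho_small_gap tau : tau' c r <= tau <= tau'' c ->
  2 * (mho (c * Num.sqrt tau) / Num.sqrt tau) < Delta * tau0 / tau.
Proof.
move=> /andP[t1 t2]; have t0 := lt_le_trans tau'_gt0 t1.
have st0 : 0 < Num.sqrt tau by rewrite sqrtr_gt0.
have := @small_gap (Num.sqrt tau)^-1.
rewrite !lef_pV2 ?posrE ?sqrtr_gt0 ?tau'_gt0 ?tau''_gt0//.
rewrite !ler_sqrt ?(ltW t0) ?(ltW tau''_gt0)//.
rewrite ?t1 ?t2 => /(_ isT); rewrite mulrC ltr_pdivrMr// => h.
have : mho (c * Num.sqrt tau) < (Num.sqrt tau)^-1 * Delta * tau0 / 2.
  by rewrite ltNge mho_ge ?mulr_gt0// -ltNge.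
have -> : Delta * tau0 / tau =
    2 * ((Num.sqrt tau)^-1 * Delta * tau0 / 2 / Num.sqrt tau).
  by rewrite -{1}(sqr_sqrtr (ltW t0)); field; rewrite lt0r_neq0.
move=> {}h.
by rewrite ltr_pM2l// ltr_pM2r// invr_gt0.
Qed.

Lemma mho_gap tau : 0 < tau <= tau' c r ->
  mho (c * Num.sqrt tau) / Num.sqrt tau - mho (c * scale tau) / scale tau <
  Delta * tau0 / tau.
Proof.
move=> /andP[t0 t1].
have st0 : 0 < Num.sqrt tau by rewrite sqrtr_gt0.
have st'0 : 0 < Num.sqrt (tau' c r) by rewrite sqrtr_gt0 tau'_gt0.
have sct0 : 0 < scale tau by rewrite sqrtr_gt0 divr_gt0 ?mulr_gt0 ?addr_gt0.
have sst'0 : 0 < Num.sqrt (tau'' c) by rewrite sqrtr_gt0 tau''_gt0.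
have t'2 : tau' c r <= tau'' c.
  rewrite -(ler_pM2l r_gt0) -tau'_eq; have := tau'_gt0; nra.
have rw : scale tau ^+ 2 = tau * (tau + r) / r.
  by rewrite sqr_sqrtr// divr_ge0 ?mulr_ge0 ?addr_ge0 ?ltW.
set u := mho (c * Num.sqrt tau); set v := mho (c * scale tau).
pose u1 := mho (c * Num.sqrt (tau' c r)).
have Ou : Omega u = c * Num.sqrt tau by rewrite mhoK ?mulr_gt0.
have Ov : Omega v = c * scale tau by rewrite mhoK ?mulr_gt0.
have Ou1 : Omega u1 = c * Num.sqrt (tau' c r) by rewrite mhoK ?mulr_gt0.
(* The ratio [Omega u / Omega v]; [k1] is its value at [tau'], where [v] would be 0. As
   [k ^+ 2 = r / (tau + r)] decreases in [tau], [k1 <= k <= 1]. *)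
pose k := Num.sqrt tau / scale tau.
pose k1 := Num.sqrt (tau' c r) / Num.sqrt (tau'' c).
have h : Omega u * (u - k * v) <= 2 * u1 * Omega u1.
  apply: (@Omega_gap_bound _ u v k u1 k1).
  - rewrite mho_ge ?mulr_gt0// -Omega0_tau'' ler_pM2l// -scale_tau'.
    by rewrite scale_le ?t0.
  - rewrite -le_Omega Ou Ov ler_pM2l// ler_wsqrtr// ler_pdivlMr//.
    by rewrite ler_pM2l// lerDr ltW.
  - rewrite mho_ge ?mulr_gt0// -Omega0_tau'' ler_pM2l// ler_sqrt//.
    exact/ltW/tau''_gt0.
  - by rewrite -le_Omega Ou Ou1 ler_pM2l// ler_wsqrtr.
  - by rewrite Ou Ov /k; field; rewrite lt0r_neq0.
  - by rewrite Ou1 -Omega0_tau'' /k1; field; rewrite lt0r_neq0.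
  - have k0 : 0 <= k by rewrite divr_ge0 ?ltW.
    have k10 : 0 <= k1 by rewrite divr_ge0 ?ltW.
    have tr : 0 < tau + r by rewrite addr_gt0.
    have t'r : 0 < tau' c r + r := addr_gt0 tau'_gt0 r_gt0.
    have k2 : k ^+ 2 = r / (tau + r).
      rewrite expr_div_n rw sqr_sqrtr ?ltW//.
      by field; rewrite !lt0r_neq0// addr_gt0.
    have k12 : k1 ^+ 2 = r / (tau' c r + r).
      rewrite expr_div_n !sqr_sqrtr ?(ltW tau'_gt0) ?(ltW tau''_gt0)//.
      apply/eqP; rewrite eqr_div ?(lt0r_neq0 tau''_gt0) ?(lt0r_neq0 t'r)//.
      by rewrite tau'_eq.
    rewrite -(@ler_pXn2r _ 2)// k12 k2 ler_pM2l// lef_pV2//.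
    rewrite lerD2r t1/= -(@expr_le1 _ 2)// k2 ler_pdivrMr//.
    by rewrite mul1r lerDr ltW.
have := @mho_small_gap (tau' c r); rewrite lexx t'2 => /(_ isT).
rewrite -/u1 -[in X in _ < X](sqr_sqrtr (ltW tau'_gt0)).
rewrite ltr_pdivlMr ?exprn_gt0// => h'.
rewrite -[in X in _ < X](sqr_sqrtr (ltW t0)) ltr_pdivlMr ?exprn_gt0//.
apply: le_lt_trans h'.
(* Multiplied by its precision, the width of the band is [Delta * tau0] both at [tau] and at [tau'];
   the gaps, multiplied also by [c], are the two sides of [h]. *)
rewrite -(ler_pM2l c_gt0).
have -> : c * ((u / Num.sqrt tau - v / scale tau) * Num.sqrt tau ^+ 2) =
    Omega u * (u - k * v).
  by rewrite Ou /k; field; rewrite !lt0r_neq0.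
have -> // : c * (2 * (u1 / Num.sqrt (tau' c r)) * Num.sqrt (tau' c r) ^+ 2) =
    2 * u1 * Omega u1.
by rewrite Ou1; field; rewrite lt0r_neq0.
Qed.

(** Such a band would lie strictly between [Stop0] and [Stop1] and, being an interval, on one side
    of a nonempty [Continue]; either way it would be too narrow. *)
Lemma band_not_indeterminate tau m : 0 < tau ->
  ~ (band tau0 Delta tau m `<=` Indeterminate c r).
Proof.
move=> t0 sub; set w := Delta * tau0 / tau in sub.
have w0 : 0 < w by rewrite divr_gt0 ?mulr_gt0.
set ms := mho (c * Num.sqrt tau) / Num.sqrt tau.
have inband x : m <= x <= m + w ->
    [/\ Num.min 0 (- ms) < x, x < Num.max 0 ms &
        ~ `|x| <= mho (c * scale tau) / scale tau].
  move=> xm; have /sub [_ /= out] : band tau0 Delta tau m (tau, x).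
    by split => //=; rewrite in_itv/= xm.
  split.
  - rewrite ltNge; apply/negP => xs; apply: out; right.
    by split => //=; rewrite mulNr.
  - by rewrite ltNge; apply/negP => xs; apply: out; left; right.
  - by move=> xc; apply: out; left; left.
have [|ms1 ms2 nc1] := inband m.
  by rewrite lexx lerDl ltW.
have [|ms3 ms4 nc2] := inband (m + w).
  by rewrite lexx lerDl ltW.
(* If [ms <= 0], the two stopping regions leave no mean between them. *)
have [ms0|ms0] := leP ms 0.
  move: ms1 ms4; rewrite max_l// min_l ?oppr_ge0//; lra.
rewrite min_r ?oppr_le0 ?ltW// in ms1 ms3; rewrite max_r ?ltW// in ms2 ms4.
have st0 : 0 < Num.sqrt tau by rewrite sqrtr_gt0.
have t2 : tau <= tau'' c.
  rewrite leNgt; apply/negP => t2.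
  have : mho (c * Num.sqrt tau) <= 0.
    by rewrite mho_le ?mulr_gt0// -Omega0_tau'' ler_pM2l// ler_sqrt ltW.
  by apply/negP; rewrite -ltNge -(pmulr_lgt0 _ (_ : 0 < (Num.sqrt tau)^-1)) ?invr_gt0.
have [t1|t1] := leP (tau' c r) tau.
  have := @mho_small_gap tau; rewrite t1 t2 => /(_ isT); rewrite -/ms -/w; lra.
have := @mho_gap tau; rewrite t0 ltW// => /(_ isT); rewrite -/ms -/w.
set mc := mho (c * scale tau) / scale tau => gap.
(* Below [tau'], [Continue] contains the mean 0. *)
have mc0 : 0 <= mc.
  have sct0 : 0 < scale tau by rewrite sqrtr_gt0 divr_gt0 ?mulr_gt0 ?addr_gt0.
  apply: divr_ge0; last exact: ltW.
  rewrite mho_ge ?mulr_gt0// -Omega0_tau'' ler_pM2l// -scale_tau'.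
  by rewrite scale_le ?t0 ?ltW.
(* The band is to the right of 0, to the left of 0, or contains 0. In the first two cases [gap]
   forces its end nearer to 0 into [Continue]. *)
have [m0|m0] := ltP 0 m.
  by apply: nc1; rewrite gtr0_norm//; rewrite /mc in gap *; lra.
have [mw0|mw0] := ltP (m + w) 0.
  by apply: nc2; rewrite ltr0_norm//; rewrite /mc in gap *; lra.
have [|_ _] := inband 0; first by rewrite m0.
by apply; rewrite normr0.
Qed.

End regions_gap.
(** * Gaussian integrals *)

Section integral_lemmas.
Context {R : realType}.
Implicit Types m s q : R.
Local Open Scope ereal_scope.

(* Unlike in ge0_le_integral, f and g need not be measurable: measurability of the
   optimal risk as a function of the state is not known. *)
Lemma le_integral_nonneg d (T : measurableType d) (mu : {measure set T -> \bar R})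
    (f g : T -> \bar R) :
  (forall x, 0 <= f x) -> (forall x, f x <= g x) ->
  \int[mu]_x f x <= \int[mu]_x g x.
Proof.
move=> f0 fg; have g0 x : 0 <= g x by exact: le_trans (fg x).
rewrite !ge0_integralTE//; apply: le_ereal_sup => _ [h hf <-].
by exists h => // x; exact: le_trans (fg x).
Qed.

Let integral_normal_indic m s (E : set R) : measurable E ->
  \int[normal_prob m s]_x (\1_E x)%:E =
  \int[lebesgue_measure]_x ((\1_E x)%:E * (normal_pdf m s x)%:E).
Proof.
move=> mE; rewrite integral_indic//= setIT /normal_prob [LHS]integral_mkcond/=.
apply: eq_integral => x _; rewrite patchE indicE.
by case: (x \in E); rewrite ?mul1e ?mul0e.
Qed.

Import HBNNSimple.

Let integral_normal_nnsfun m s (h : {nnsfun _ >-> R}) :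
  \int[normal_prob m s]_x (h x)%:E =
  \int[lebesgue_measure]_x ((h x)%:E * (normal_pdf m s x)%:E).
Proof.
have mpdf : measurable_fun setT (EFin \o (normal_pdf m s)).
  by apply/measurable_EFinP; exact: measurable_normal_pdf.
under [LHS]eq_integral do rewrite fimfunE -fsumEFin//.
rewrite [LHS]ge0_integral_fsum//; last 2 first.
  - by move=> r; exact/measurable_EFinP/measurableT_comp.
  - by move=> n x _; rewrite EFinM nnfun_muleindic_ge0.
under [RHS]eq_integral.
  move=> x _; rewrite fimfunE -fsumEFin// ge0_mule_fsuml; last first.
    by move=> r; rewrite EFinM nnfun_muleindic_ge0.
  over.
rewrite [RHS]ge0_integral_fsum//; last 2 first.
  - move=> r; apply: emeasurable_funM => //.
    by apply/measurable_EFinP; do 2 apply/measurableT_comp => //.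
  - move=> n x _; rewrite mule_ge0//; last by rewrite lee_fin normal_pdf_ge0.
    by rewrite EFinM nnfun_muleindic_ge0.
apply: eq_fsbigr => r _.
(* A negative value is not taken by [h], so both integrals vanish. *)
have [r0|r0] := leP 0%R r; last first.
  by rewrite !integral0_eq// => x _; rewrite preimage_nnfun0// indic0 mulr0 ?mul0e.
have mind : measurable_fun setT (fun x : measurableTypeR R =>
    (\1_(h @^-1` [set r]) x)%:E : \bar R).
  exact/measurable_EFinP.
under eq_integral do rewrite EFinM.
rewrite ge0_integralZl//.
have mE : measurable (h @^-1` [set r]) by exact: measurable_sfunP.
rewrite (integral_normal_indic _ _ mE).
under [RHS]eq_integral do rewrite EFinM -muleA.
rewrite ge0_integralZl//; first exact: emeasurable_funM.
by move=> x _; rewrite mule_ge0 ?lee_fin ?normal_pdf_ge0.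
Qed.

(** The density formula, extended from indicators to simple functions and then by monotone
    convergence. *)
Lemma ge0_integral_normal_prob m s (f : R -> \bar R) :
  measurable_fun setT f -> (forall x, 0 <= f x) ->
  \int[normal_prob m s]_x f x =
  \int[lebesgue_measure]_x (f x * (normal_pdf m s x)%:E).
Proof.
move=> mf f0; pose f_ := @nnsfun_approx _ (measurableTypeR R) _ _ measurableT f mf.
have fE x : lim ((f_ n x)%:E @[n --> \oo]) = f x.
  by apply/cvg_lim => //; exact: cvg_nnsfun_approx.
have mf_ n : measurable_fun setT (fun x => (f_ n x)%:E).
  exact/measurable_EFinP/measurable_funTS.
transitivity (lim (\int[normal_prob m s]_x (f_ n x)%:E @[n --> \oo])).
  rewrite -monotone_convergence//=.
  - by apply: eq_integral => x _; rewrite fE.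
  - by move=> n x _; rewrite lee_fin.
  - by move=> x _ a b ab; rewrite lee_fin; exact/lefP/nd_nnsfun_approx.
under eq_fun do rewrite integral_normal_nnsfun.
rewrite -monotone_convergence//=.
- apply: eq_integral => x _; rewrite -fE; apply/cvg_lim => //.
    apply: cvgeZr => //; rewrite fE; exact: cvg_nnsfun_approx.
- move=> n; apply: emeasurable_funM => //; apply/measurable_EFinP.
  exact: measurable_normal_pdf.
- by move=> n x _; rewrite mule_ge0 ?lee_fin ?normal_pdf_ge0.
- move=> x _ a b ab; rewrite lee_wpmul2r ?lee_fin ?normal_pdf_ge0//.
  exact/lefP/nd_nnsfun_approx.
Qed.

(** Substitution [x = m + s * z], whose Jacobian [s] turns the density at [x] into the standard one
    at [z]. *)
Lemma integral_normal_affine m s (f : R -> R) : (0 < s)%R ->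
  continuous f -> (forall x, 0 <= f x)%R ->
  \int[normal_prob m s]_x (f x)%:E =
  \int[normal_prob 0%R 1%R]_z (f (m + s * z)%R)%:E.
Proof.
move=> s0 cf f0; pose F := ((cst m + s *: @id R) : R -> R)%R.
have dF x : is_derive x (1 : R)%R F s.
  have hZ := is_deriveZ s (is_derive_id x (1 : R)%R).
  apply: is_derive_eq (is_deriveD (is_derive_cst m x (1 : R)%R) hZ) _.
  by rewrite add0r /GRing.scale/= mulr1.
have F'E : F^`()%classic = cst s.
  by apply/funext => x; rewrite derive1E; have [] := dF x.
have FE x : F x = (m + s * x)%R by [].
have cF : continuous F.
  by move=> x; apply/differentiable_continuous/derivable1_diffP; have [] := dF x.
rewrite !ge0_integral_normal_prob.
- under eq_integral do rewrite -EFinM.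
  rewrite (@increasing_ge0_integration_by_substitutionT _ F
    (fun x => f x * normal_pdf m s x)%R).
  + apply: eq_integral => z _; rewrite F'E -EFinM !fctE/= FE -mulrA; congr (_ * _)%:E.
    rewrite !normal_pdfE ?oner_neq0 ?lt0r_neq0// /normal_fun.
    rewrite mulrAC; congr (_ * expR _)%R.
      rewrite /normal_peak expr1n mul1r -mulrnAr sqrtrM ?sqr_ge0// sqrtr_sqr.
      by rewrite gtr0_norm// invfM mulrAC mulVf ?mul1r// lt0r_neq0.
    by field; rewrite lt0r_neq0.
  + by move=> x y xy; rewrite !FE ltrD2l ltr_pM2l.
  + by rewrite F'E => x; exact: cvg_cst.
  + by rewrite F'E; exact: is_cvg_cst.
  + by rewrite F'E; exact: is_cvg_cst.
  + by move=> x; have [] := dF x.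
  + apply/cvgrNyPle => A; exists ((A - m) / s)%R; split => [|x]; first exact: num_real.
    by rewrite ltr_pdivlMr// ltrBrDl mulrC => /ltW.
  + apply/cvgryPge => A; exists ((A - m) / s)%R; split => [|x]; first exact: num_real.
    by rewrite ltr_pdivrMr// ltrBlDl mulrC => /ltW.
  + move=> x; apply: cvgM; first exact: cf.
    by apply: continuous_normal_pdf; rewrite lt0r_neq0.
  + by move=> x; rewrite mulr_ge0 ?normal_pdf_ge0.
- apply/measurable_EFinP; apply: (@continuous_measurable_fun R (f \o F)%R).
  by move=> x; apply: continuous_comp; [exact: cF|exact: cf].
- by move=> x; rewrite lee_fin.
- by apply/measurable_EFinP; exact: continuous_measurable_fun.
- by move=> x; rewrite lee_fin.
Qed.

Let continuous_hinge q : continuous (fun x : R => Num.max (x - q) 0)%R.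
Proof.
move=> x; apply: (@continuous_max R R (fun x => x - q)%R (cst 0%R)).
  by apply: cvgB; [exact: cvg_id|exact: cvg_cst].
exact: cvg_cst.
Qed.

Let continuous_hingeN q : continuous (fun x : R => Num.max (q - x) 0)%R.
Proof.
move=> x; apply: (@continuous_max R R (fun x => q - x)%R (cst 0%R)).
  by apply: cvgB; [exact: cvg_cst|exact: cvg_id].
exact: cvg_cst.
Qed.

Lemma integral_std_normal_hinge q :
  \int[normal_prob 0%R 1%R]_z (Num.max (z - q) 0)%:E = (Omega q)%:E.
Proof.
rewrite ge0_integral_normal_prob.
- rewrite -integral_itvcy_Omega [RHS]integral_mkcond; apply: eq_integral => z _.
  rewrite patchE; case: ifPn => [|].
    rewrite inE/= in_itv/= andbT => qz.
    by rewrite max_l ?subr_ge0.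
  rewrite notin_setE/= in_itv/= andbT => /negP; rewrite -ltNge => zq.
  by rewrite max_r ?mul0e// subr_le0 ltW.
- by apply/measurable_EFinP; apply: continuous_measurable_fun.
- by move=> z; rewrite lee_fin le_max lexx orbT.
Qed.

Lemma integral_std_normal_hingeN q :
  \int[normal_prob 0%R 1%R]_z (Num.max (q - z) 0)%:E = (Omega (- q))%:E.
Proof.
rewrite ge0_integral_normal_prob.
- rewrite -integral_itvcy_Omega.
  (* The endpoint is written [- - q] so that the reflection yields the half-line starting at
     [- q]. *)
  transitivity (\int[lebesgue_measure]_(z in `]-oo, (- - q)%R])
      ((q - z) * normal_pdf 0 1 z)%:E).
    rewrite opprK [RHS]integral_mkcond; apply: eq_integral => z _.
    rewrite patchE; case: ifPn => [|].
      by rewrite inE/= in_itv/= => zq; rewrite max_l ?subr_ge0.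
    rewrite notin_setE/= in_itv/= => /negP; rewrite -ltNge => zq.
    by rewrite max_r ?mul0e// subr_le0 ltW.
  rewrite ge0_integration_by_substitutionNy.
  + apply: eq_integral => z _ /=.
    by rewrite std_normal_pdf_even !opprK addrC.
  + apply: continuous_subspaceT => z; apply: cvgM; last exact: continuous_std_normal_pdf.
    by apply: cvgB; [exact: cvg_cst|exact: cvg_id].
  + move=> z; rewrite in_itv/= opprK => zq.
    by rewrite mulr_ge0 ?normal_pdf_ge0// subr_ge0 ltW.
- by apply/measurable_EFinP; apply: continuous_measurable_fun.
- by move=> z; rewrite lee_fin le_max lexx orbT.
Qed.

Lemma integral_normal_hinge m s q : (0 < s)%R ->
  \int[normal_prob m s]_x (Num.max (x - q) 0)%:E = (s * Omega ((q - m) / s))%:E.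
Proof.
move=> s0.
rewrite (@integral_normal_affine m s (fun x => Num.max (x - q) 0))%R//; last first.
  by move=> x; rewrite le_max lexx orbT.
rewrite EFinM -integral_std_normal_hinge -ge0_integralZl//.
- apply: eq_integral => z _; rewrite -EFinM maxr_pMr ?(ltW s0)// mulr0.
  by congr (Num.max _ _)%:E; field; rewrite lt0r_neq0.
- by apply/measurable_EFinP; apply: continuous_measurable_fun.
- by move=> z _; rewrite lee_fin le_max lexx orbT.
- by rewrite lee_fin ltW.
Qed.

Lemma integral_normal_hingeN m s q : (0 < s)%R ->
  \int[normal_prob m s]_x (Num.max (q - x) 0)%:E = (s * Omega ((m - q) / s))%:E.
Proof.
move=> s0.
rewrite (@integral_normal_affine m s (fun x => Num.max (q - x) 0))%R//; last first.
  by move=> x; rewrite le_max lexx orbT.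
have -> : ((m - q) / s = - ((q - m) / s))%R by rewrite -mulNr opprB.
rewrite EFinM -integral_std_normal_hingeN -ge0_integralZl//.
- apply: eq_integral => z _; rewrite -EFinM maxr_pMr ?(ltW s0)// mulr0.
  by congr (Num.max _ _)%:E; field; rewrite lt0r_neq0.
- by apply/measurable_EFinP; apply: continuous_measurable_fun.
- by move=> z _; rewrite lee_fin le_max lexx orbT.
- by rewrite lee_fin ltW.
Qed.

End integral_lemmas.

(** * Bayes' rule and the predictive distribution *)

Lemma measurable_normal_pdf_comp d (T : measurableType d) (R : realType)
    (g h : T -> R) (s : R) : s != 0 ->
  measurable_fun setT g -> measurable_fun setT h ->
  measurable_fun setT (fun z => normal_pdf (g z) s (h z)).
Proof.
move=> s0 mg mh; under eq_fun do rewrite normal_pdfE//.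
apply: measurable_funM => //; apply: measurableT_comp => //.
apply: measurable_funM => //; apply: measurableT_comp => //.
by apply: measurable_funX; exact: measurable_funB.
Qed.

Section posterior.
Context {R : realType}.
Variables (mu tau r : R).
Hypotheses (tau_gt0 : 0 < tau) (r_gt0 : 0 < r).

Let normal_pdf_sqrt (m v x : R) : 0 < v ->
  normal_pdf m (Num.sqrt v) x =
  (Num.sqrt v)^-1 * (Num.sqrt (pi *+ 2))^-1 * expR (- ((x - m) ^+ 2 / (v *+ 2))).
Proof.
move=> v0; rewrite normal_pdfE; last by rewrite gt_eqF// sqrtr_gt0.
rewrite /normal_fun /normal_peak sqr_sqrtr ?(ltW v0)// -mulrnAr sqrtrM ?(ltW v0)//.
by rewrite invfM mulNr.
Qed.

(* Bayes' rule: joint density of observation and parameter, factored as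
   predictive times posterior and as prior times likelihood. *)
Lemma normal_pdf_bayes (x t : R) :
  normal_pdf mu (Num.sqrt (1 / tau + 1 / r)) x *
    normal_pdf ((tau * mu + r * x) / (tau + r)) (Num.sqrt (1 / (tau + r))) t =
  normal_pdf mu (Num.sqrt (1 / tau)) t * normal_pdf t (Num.sqrt (1 / r)) x.
Proof.
have tr : 0 < tau + r by rewrite addr_gt0.
have t1 : 0 < 1 / tau by rewrite divr_gt0.
have r1 : 0 < 1 / r by rewrite divr_gt0.
have tr1 : 0 < 1 / (tau + r) by rewrite divr_gt0.
have t1r1 : 0 < 1 / tau + 1 / r by rewrite addr_gt0.
rewrite !normal_pdf_sqrt//; set p := (Num.sqrt (pi *+ 2))^-1.
rewrite mulrACA [RHS]mulrACA -!expRD; congr (_ * expR _).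
  (* The normalizing factors agree because the products of the two variances do; the exponents agree
     by completing the square. *)
  rewrite mulrACA [RHS]mulrACA; congr (_ * _); rewrite -!invfM; congr _^-1.
  rewrite -!sqrtrM ?(ltW t1r1) ?(ltW t1)//; congr Num.sqrt.
  by field; rewrite !lt0r_neq0.
by field; rewrite !lt0r_neq0.
Qed.

Local Open Scope ereal_scope.

(** The law of total expectation: after Bayes' rule and Tonelli's theorem, the inner integral is the
    total mass 1 of the likelihood. *)
Lemma integral_predictive_posterior (f : R -> \bar R) :
  measurable_fun setT f -> (forall t, 0 <= f t) ->
  \int[normal_prob mu (Num.sqrt (1 / tau + 1 / r))]_x
    \int[normal_prob ((tau * mu + r * x) / (tau + r)) (Num.sqrt (1 / (tau + r)))]_t
      f t =
  \int[normal_prob mu (Num.sqrt (1 / tau))]_t f t.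
Proof.
move=> mf f0.
have mf' : measurable_fun setT (f : measurableTypeR R -> _) := mf.
have mpdf m s : measurable_fun setT (fun x : measurableTypeR R => (normal_pdf m s x)%:E).
  by apply/measurable_EFinP; exact: measurable_normal_pdf.
pose m x := ((tau * mu + r * x) / (tau + r))%R.
have post : measurable_fun setT (fun xt : measurableTypeR R * measurableTypeR R =>
    f xt.2 * (normal_pdf (m xt.1) (Num.sqrt (1 / (tau + r))) xt.2)%:E).
  apply: emeasurable_funM; first exact: measurableT_comp.
  apply/measurable_EFinP; apply: measurable_normal_pdf_comp => //.
    by rewrite gt_eqF// sqrtr_gt0 divr_gt0// addr_gt0.
  apply: measurable_funM => //; apply: measurable_funD => //.
  exact: measurable_funM.
have pf0 (x t n s : R) : 0 <= f t * (normal_pdf n s x)%:E.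
  by rewrite mule_ge0 ?lee_fin ?normal_pdf_ge0.
rewrite [LHS]ge0_integral_normal_prob; last 2 first.
- under eq_fun do rewrite ge0_integral_normal_prob//.
  apply: (@measurable_fun_fubini_tonelli_F _ _ _ _ _ lebesgue_measure _ post).
  by move=> xt.
- by move=> x; exact: integral_ge0.
rewrite [RHS](ge0_integral_normal_prob _ _ mf f0).
transitivity (\int[lebesgue_measure]_x \int[lebesgue_measure]_t
    (f t * (normal_pdf mu (Num.sqrt (1 / tau)) t)%:E *
     (normal_pdf t (Num.sqrt (1 / r)) x)%:E)).
  apply: eq_integral => x _; rewrite (ge0_integral_normal_prob _ _ mf f0).
  set k := normal_pdf mu _ x.
  transitivity (\int[lebesgue_measure]_t ((f t *
      (normal_pdf (m x) (Num.sqrt (1 / (tau + r))) t)%:E) * k%:E)).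
    apply/esym; apply: ge0_integralZr => //.
      exact: (emeasurable_funM mf' (mpdf _ _)).
    by rewrite lee_fin normal_pdf_ge0.
  apply: eq_integral => t _; rewrite -!muleA -!EFinM; congr (_ * _%:E).
  by rewrite mulrC normal_pdf_bayes.
rewrite (@fubini_tonelli _ _ _ _ _ lebesgue_measure lebesgue_measure (fun xt =>
  f xt.2 * (normal_pdf mu (Num.sqrt (1 / tau)) xt.2)%:E *
  (normal_pdf xt.2 (Num.sqrt (1 / r)) xt.1)%:E))/=.
- apply: eq_integral => t _; rewrite ge0_integralZl//.
    by rewrite integral_normal_pdf mule1.
  by move=> x _; rewrite lee_fin normal_pdf_ge0.
- apply: emeasurable_funM.
    exact: (measurableT_comp (emeasurable_funM mf' (mpdf _ _)) measurable_snd).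
  apply/measurable_EFinP; apply: measurable_normal_pdf_comp => //.
  by rewrite gt_eqF// sqrtr_gt0 divr_gt0.
- by move=> xt; rewrite !mule_ge0 ?lee_fin ?normal_pdf_ge0.
Qed.

End posterior.
(** * Bayes risk *)

Section stopping_risk.
Context {R : realType}.
Implicit Types tau mu : R.

Lemma loss_ge0 (t : R) b : 0 <= loss t b.
Proof. by rewrite /loss; case: b; rewrite le_max lexx orbT. Qed.

Lemma continuous_loss b : continuous (fun t : R => loss t b).
Proof.
move=> x; case: b.
  by apply: (@continuous_max R R (-%R) (cst 0)); [exact: oppr_continuous|exact: cvg_cst].
by apply: (@continuous_max R R id (cst 0)); [exact: cvg_id|exact: cvg_cst].
Qed.

Lemma measurable_loss b : measurable_fun setT (fun t : R => (loss t b)%:E).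
Proof.
apply/measurable_EFinP; apply: continuous_measurable_fun.
exact: continuous_loss.
Qed.

Lemma sqrt_1div (x : R) : 0 < x -> Num.sqrt (1 / x) = (Num.sqrt x)^-1.
Proof. by move=> x0; rewrite div1r sqrtrV// ltW. Qed.

Lemma expected_loss_d1 mu tau : 0 < tau ->
  expected_loss mu tau d1 = (Omega (Num.sqrt tau * mu) / Num.sqrt tau)%:E.
Proof.
move=> t0; rewrite /expected_loss /loss/=.
under eq_integral do rewrite -[(- _)%R]add0r.
rewrite integral_normal_hingeN ?sqrtr_gt0 ?divr_gt0// subr0 sqrt_1div// invrK.
by rewrite mulrC [(mu * _)%R]mulrC.
Qed.

Lemma expected_loss_d0 mu tau : 0 < tau ->
  expected_loss mu tau d0 = (Omega (- (Num.sqrt tau * mu)) / Num.sqrt tau)%:E.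
Proof.
move=> t0; rewrite /expected_loss /loss/=.
under eq_integral do rewrite -[X in Num.max X _]subr0.
rewrite integral_normal_hinge ?sqrtr_gt0 ?divr_gt0// sub0r sqrt_1div// invrK.
by rewrite mulrC mulNr [(mu * _)%R]mulrC.
Qed.

(** Expresses [risk0] as the expected loss of [d0] minus the positive part of the mean. *)
Lemma Omega_abs (x : R) : Omega `|x| = Omega (- x) - Num.max x 0.
Proof.
have [x0|x0] := leP 0 x.
  by rewrite ger0_norm// OmegaN addrK.
by rewrite ltr0_norm// subr0.
Qed.

End stopping_risk.

(** * Sufficient conditions for stopping and for continuing *)

Section gaussian_model.
Context {R : realType} {d : measure_display} {T : measurableType d}.
Variables (c r : R) (P : R -> R -> probability T R).
Variables (theta : T -> R) (X : nat -> T -> R).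
Hypotheses (c_gt0 : 0 < c) (r_gt0 : 0 < r).
Hypothesis model : gaussian_model r P theta X.
Implicit Types mu tau : R.
Local Open Scope ereal_scope.

(** The case of no observations in [gaussian_model] says that [theta] has the prior law. *)
Lemma integral_theta mu tau (f : R -> \bar R) : (0 < tau)%R ->
  measurable_fun setT f -> (forall t, 0 <= f t) ->
  \int[P mu tau]_w f (theta w) =
  \int[normal_prob mu (Num.sqrt (1 / tau))]_t f t.
Proof.
move=> t0 mf f0; have [mtheta _ law] := model.
have := @ge0_integral_pushforward _ _ T (measurableTypeR R) R theta mtheta
  (P mu tau) setT f measurableT mf.
rewrite preimage_setT => <-; last by move=> y _.
apply: (@eq_measure_integral _ (measurableTypeR R)) => A mA _.
have := law mu tau t0 A 0%N (fun=> setT) mA (fun=> measurableT).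
rewrite bigcap_mkord big_ord0 setIT => lawA; apply: (etrans lawA).
under eq_integral do rewrite big_ord0.
by rewrite integral_cst// mul1e.
Qed.

Definition stop_now (b : decision) : plan R :=
  @Plan R (fun _ _ => true) (fun _ _ => b)
    (fun _ => @measurable_cst _ _ _ _ _ _) (fun _ => @measurable_cst _ _ _ _ _ _).

Lemma total_loss_stopped (delta : plan R) t x :
  stop delta (observed x 0) ->
  total_loss c delta t x = (loss t (decide delta (observed x 0)))%:E.
Proof.
move=> s0; rewrite /total_loss; case: pselect => [ex|nex].
  case: ex_minnP => n sn /(_ 0%N s0); rewrite leqn0 => /eqP n0.
  by subst n; rewrite mul0r addr0.
by exfalso; apply: nex; exists 0%N.
Qed.

Lemma risk_of_stopped mu tau (delta : plan R) b : (0 < tau)%R ->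
  (forall x, stop delta (observed x 0)) ->
  (forall x, decide delta (observed x 0) = b) ->
  risk_of c P theta X mu tau delta = expected_loss mu tau b.
Proof.
move=> t0 s0 db; rewrite /risk_of.
under eq_integral do rewrite total_loss_stopped ?s0// db.
apply: (@integral_theta mu tau (fun t => (loss t b)%:E)) => //.
- exact: measurable_loss.
- by move=> t; rewrite lee_fin loss_ge0.
Qed.

Lemma risk_le_expected_loss mu tau b : (0 < tau)%R ->
  risk c P theta X mu tau <= expected_loss mu tau b.
Proof.
move=> t0; rewrite -(@risk_of_stopped mu tau (stop_now b) b)//.
by apply: ereal_inf_lbound; exists (stop_now b).
Qed.

Lemma total_loss_ge0 (delta : plan R) t x : 0 <= total_loss c delta t x.
Proof.
rewrite /total_loss; case: pselect => // ex.
by rewrite lee_fin addr_ge0 ?loss_ge0// mulr_ge0// ltW.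
Qed.

Lemma risk_ge0 mu tau : 0 <= risk c P theta X mu tau.
Proof.
apply: le_ereal_inf_tmp => _ [delta _ <-].
by apply: integral_ge0 => w _; exact: total_loss_ge0.
Qed.

(* A plan either stops at once, or pays for at least one observation. *)
Lemma optimal_stop_of_le_cost mu tau b : (0 < tau)%R ->
  expected_loss mu tau b <= c%:E ->
  (forall b', expected_loss mu tau b <= expected_loss mu tau b') ->
  optimal_stop c P theta X mu tau b.
Proof.
move=> t0 ELc ELb; apply/eqP; rewrite eq_le risk_le_expected_loss//=.
apply: le_ereal_inf_tmp => _ [delta _ <-].
(* There is a single empty tuple, so whether a plan stops at once, and its decision then, do not
   depend on the data. *)
have obs0 x y : observed x 0 = observed y 0 :> 0.-tuple R.
  by apply: eq_from_tnth => -[].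
case sd : (stop delta (observed (fun=> 0%R) 0)).
  rewrite (@risk_of_stopped mu tau delta (decide delta (observed (fun=> 0%R) 0)))//.
  - by move=> x; rewrite (obs0 _ (fun=> 0%R)).
  - by move=> x; rewrite (obs0 _ (fun=> 0%R)).
apply: (le_trans ELc).
have <- : \int[P mu tau]_w c%:E = c%:E.
  by rewrite integral_cst// -[RHS]mule1; congr (_ * _); exact: probability_setT.
apply: le_integral_nonneg => w; first by rewrite lee_fin ltW.
rewrite /total_loss; case: pselect => [ex|_]; last exact: leey.
case: ex_minnP => -[|n]; first by rewrite (obs0 _ (fun=> 0%R)) sd.
move=> _ _; rewrite lee_fin ler_wpDl ?loss_ge0// ler_peMl ?ler1n//.
exact: ltW.
Qed.

(* risk0 m t is the expectation of max(theta, 0) minus max(m, 0); on average over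
   the next observation, the posterior expectation of max(theta, 0) is the prior
   one, and the next mean is Gaussian with standard deviation 1 / s. *)
Lemma integral_predictive_risk0 mu tau : (0 < tau)%R ->
  let s := Num.sqrt (tau * (tau + r) / r) in
  \int[normal_prob mu (Num.sqrt (1 / tau + 1 / r))]_x
    (risk0 ((tau * mu + r * x) / (tau + r)) (tau + r))%:E =
  (risk0 mu tau - Omega (s * `|mu|) / s)%:E.
Proof.
move=> t0 s; have tr0 : (0 < tau + r)%R by rewrite addr_gt0.
have s0 : (0 < s)%R by rewrite sqrtr_gt0 divr_gt0 ?mulr_gt0.
have st0 : (0 < Num.sqrt tau)%R by rewrite sqrtr_gt0.
have str0 : (0 < Num.sqrt (tau + r))%R by rewrite sqrtr_gt0.
set N := normal_prob mu _; pose m x := ((tau * mu + r * x) / (tau + r))%R.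
have max_pM (k a : R) : (0 < k)%R -> Num.max (k * a)%R 0%R = (k * Num.max a 0)%R.
  by move=> k0; rewrite maxr_pMr ?mulr0// ltW.
have risk0E (a b : R) : (0 < b)%R -> (risk0 a b + Num.max a 0 =
    Omega (- (Num.sqrt b * a)) / Num.sqrt b)%R.
  move=> b0; have sb0 : (0 < Num.sqrt b)%R by rewrite sqrtr_gt0.
  rewrite /risk0 -[X in (X * `|a|)%R](ger0_norm (ltW sb0)) -normrM Omega_abs max_pM//.
  by field; rewrite lt0r_neq0.
have mm : measurable_fun setT (m : measurableTypeR R -> R).
  apply: measurable_funM => //; apply: measurable_funD => //; exact: measurable_funM.
have hinge : \int[N]_x (Num.max (m x) 0)%:E = (Omega (- (s * mu)) / s)%:E.
  set v := (1 / tau + 1 / r)%R in N *.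
  have v0 : (0 < v)%R by rewrite addr_gt0 ?divr_gt0.
  have sv0 : (0 < Num.sqrt v)%R by rewrite sqrtr_gt0.
  (* The next mean depends on the observation with slope [r / (tau + r)], hence has standard
     deviation [1 / s]. *)
  have sE : s = ((tau + r) / r / Num.sqrt v)%R.
    apply: (@mulIf _ (Num.sqrt v)); first by rewrite lt0r_neq0.
    rewrite divfK ?lt0r_neq0// -sqrtrM; last by rewrite divr_ge0 ?mulr_ge0 ?ltW.
    rewrite -[RHS]ger0_norm ?divr_ge0 ?(ltW tr0) ?(ltW r_gt0)// -sqrtr_sqr /v.
    by congr Num.sqrt; field; rewrite !lt0r_neq0.
  (* The observation at which the next mean is 0. *)
  pose q := (- (tau * mu / r))%R.
  transitivity (\int[N]_x ((r / (tau + r))%:E * (Num.max (x - q) 0)%:E)).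
    apply: eq_integral => x _; rewrite -EFinM -max_pM ?divr_gt0//.
    by congr (Num.max _ _)%:E; rewrite /m /q; field; rewrite !lt0r_neq0.
  rewrite ge0_integralZl//; last 3 first.
  - by apply/measurable_EFinP; apply: measurable_maxr => //; exact: measurable_funB.
  - by move=> x _; rewrite lee_fin le_max lexx orbT.
  - by rewrite lee_fin divr_ge0 ?ltW.
  rewrite integral_normal_hinge// -EFinM.
  have -> : ((q - mu) / Num.sqrt v = - (s * mu))%R.
    by rewrite sE /q; field; rewrite !lt0r_neq0.
  by congr EFin; move: (Omega _) => w; rewrite sE; field; rewrite !lt0r_neq0.
(* By [risk0E] the integrand is the posterior expected loss of [d0], whose predictive average is the
   prior one. *)
have total : \int[N]_x (risk0 (m x) (tau + r) + Num.max (m x) 0)%:E =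
    (risk0 mu tau + Num.max mu 0)%:E.
  under eq_integral do rewrite risk0E// -expected_loss_d0//.
  rewrite (integral_predictive_posterior _ t0 r_gt0)//.
  - by rewrite risk0E// -expected_loss_d0.
  - exact: measurable_loss.
  - by move=> t; rewrite lee_fin loss_ge0.
have risk0_ge0 x : (0 <= risk0 (m x) (tau + r))%R.
  by rewrite divr_ge0 ?ltW ?Omega_gt0.
have : \int[N]_x (risk0 (m x) (tau + r))%:E + \int[N]_x (Num.max (m x) 0)%:E =
    (risk0 mu tau + Num.max mu 0)%:E.
  rewrite -total -ge0_integralD//.
  - by move=> x _; rewrite lee_fin.
  - apply/measurable_EFinP; apply: measurable_funM => //.
    apply: (@measurableT_comp _ _ _ _ _ _ Omega).
      by apply: continuous_measurable_fun; exact: continuous_Omega.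
    apply: measurable_funM => //.
    exact: (@measurableT_comp _ _ _ _ _ _ (@Num.norm R R)).
  - by move=> x _; rewrite lee_fin le_max lexx orbT.
  - by apply/measurable_EFinP; exact: measurable_maxr.
rewrite hinge => sumE; rewrite -[LHS](@addeK _ (Omega (- (s * mu)) / s)%:E)// sumE.
rewrite -EFinB; congr EFin.
rewrite -[X in (X * `|mu|)%R](ger0_norm (ltW s0)) -normrM Omega_abs max_pM//.
by field; rewrite lt0r_neq0.
Qed.

(** After the observation, the optimal risk is at most that of stopping with the decision favored by
    the sign of the new mean; on average this gains [Omega (s * |mu|) / s]. *)
Lemma optimal_continue_of_le mu tau : (0 < tau)%R ->
  let s := Num.sqrt (tau * (tau + r) / r) in
  (c <= Omega (s * `|mu|) / s)%R ->
  optimal_continue c r P theta X mu tau.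
Proof.
move=> t0 s cs; have tr0 : (0 < tau + r)%R by rewrite addr_gt0.
rewrite /optimal_continue.
apply: (@le_trans _ _ (c%:E + \int[normal_prob mu (Num.sqrt (1 / tau + 1 / r))]_x
    (risk0 ((tau * mu + r * x) / (tau + r)) (tau + r))%:E)).
  rewrite leeD2l//; apply: le_integral_nonneg => x; first exact: risk_ge0.
  set a := ((tau * mu + r * x) / (tau + r))%R.
  have [a0|a0] := leP 0%R a.
    apply: (le_trans (@risk_le_expected_loss a _ d1 tr0)).
    by rewrite expected_loss_d1// /risk0 ger0_norm.
  apply: (le_trans (@risk_le_expected_loss a _ d0 tr0)).
  by rewrite expected_loss_d0// /risk0 ltr0_norm// mulrN.
rewrite integral_predictive_risk0// -EFinD lee_fin -/s; lra.
Qed.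

End gaussian_model.

(** * Optimality in the three regions, and the band *)

Theorem theorem1 (R : realType) (d : measure_display) (T : measurableType d)
    (c r tau0 Delta : R)
    (P : R -> R -> probability T R) (theta : T -> R) (X : nat -> T -> R)
    (c_gt0 : 0 < c) (r_gt0 : 0 < r) (tau0_gt0 : 0 < tau0) (Delta_gt0 : 0 < Delta)
    (model : gaussian_model r P theta X)
    (small_gap : forall z : R,
       (Num.sqrt (tau'' c))^-1 <= z <= (Num.sqrt (tau' c r))^-1 ->
       z * Omega (z * Delta * tau0 / 2) < c) :
  forall tau : R, tau0 <= tau ->
    (forall mu : R,
      [/\ Stop1 c (tau, mu) -> optimal_stop c P theta X mu tau d1,
          Stop0 c (tau, mu) -> optimal_stop c P theta X mu tau d0 &
          Continue c r (tau, mu) -> optimal_continue c r P theta X mu tau]) /\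
    (forall m : R, ~ (band tau0 Delta tau m `<=` Indeterminate c r)).

Proof.
move=> tau tau0_le; have tau_gt0 : 0 < tau := lt_le_trans tau0_gt0 tau0_le.
have st_gt0 : 0 < Num.sqrt tau by rewrite sqrtr_gt0.
split; last by move=> m; exact: band_not_indeterminate.
move=> mu; split.
- move=> [_ /=]; rewrite ge_max => /andP[mu_ge0].
  (* Through [mho_le], membership in [Stop1] says that the expected loss of [d1] is at most [c]; the
     sign of [mu] makes [d1] the better decision. *)
  rewrite ler_pdivrMr// mho_le ?mulr_gt0// mulrC => le_c.
  apply: (optimal_stop_of_le_cost c_gt0 model) => //.
    by rewrite expected_loss_d1// lee_fin ler_pdivrMr.
  case; first by [].
  rewrite expected_loss_d1// expected_loss_d0// lee_fin ler_pM2r ?invr_gt0//.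
  have : 0 <= Num.sqrt tau * mu by rewrite mulr_ge0// ltW.
  by move=> ?; rewrite Omega_antitone//; lra.
- move=> [_ /=]; rewrite le_min => /andP[mu_le0].
  rewrite mulNr lerNr ler_pdivrMr// mho_le ?mulr_gt0// mulrC mulrN => le_c.
  apply: (optimal_stop_of_le_cost c_gt0 model) => //.
    by rewrite expected_loss_d0// lee_fin ler_pdivrMr.
  case; last by [].
  rewrite expected_loss_d1// expected_loss_d0// lee_fin ler_pM2r ?invr_gt0//.
  have : Num.sqrt tau * mu <= 0 by rewrite mulr_ge0_le0// ltW.
  by move=> ?; rewrite Omega_antitone//; lra.
- move=> [_ /=]; set s := Num.sqrt _ => mu_le.
  have s_gt0 : 0 < s by rewrite sqrtr_gt0 divr_gt0 ?mulr_gt0 ?addr_gt0.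
  apply: (optimal_continue_of_le c_gt0 r_gt0 model tau_gt0); rewrite -/s.
  (* Through [mho_ge], membership in [Continue] says that the gain from one observation is at least
     [c]. *)
  by rewrite ler_pdivlMr// (mulrC s) -mho_ge ?mulr_gt0// -ler_pdivlMr.
Qed.
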